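(* Let $\kappa\ge1$ and assume $\pi$ satisfies $\mathrm{MA}(\kappa)$ with constant $c_0>0$. Let $\mathcal{F}=\{f_1,\dots,f_M\}$ be a set of prediction rules $\mathcal{X}\to\{-1,1\}$. Then the ERM aggregate $\tilde f_n^{(\mathrm{ERM})}$ over $\mathcal{F}$ satisfies, for every integer $n\ge1$, $$\mathbb{E}[R(\tilde f_n^{(\mathrm{ERM})})-R^*]\le\min_{f\in\mathcal{F}}(R(f)-R^* )+C\left(\sqrt{\frac{\min_{f\in\mathcal{F}}(R(f)-R^* )^{1/\kappa}\log M}{n}}+\left(\frac{\log M}{n}\right)^{\kappa/(2\kappa-1)}\right),$$ where $C=32(6\vee537c_0\vee16(2c_0+1/3))$.
   Context: $(X,Y)$ is a random pair on $\mathcal{X}\times\{-1,1\}$ with distribution $\pi$; $D_n=((X_i,Y_i))_{i=1}^n$ are i.i.d. copies. $\eta(x)=\mathbb{P}(Y=1\mid X=x)$, $f^*=\mathrm{sign}(2\eta-1)$, $R(f)=\mathbb{P}(Y\ne f(X))$ (conditionally on $D_n$ for data-dependent $f$), $R^*=R(f^* )$. $\mathrm{MA}(\kappa)$ with constant $c_0$: $\mathbb{E}|f(X)-f^*(X)|\le c_0(R(f)-R^* )^{1/\kappa}$ for all measurable $f:\mathcal{X}\to\{-1,1\}$. The ERM aggregate is one element of $\mathcal{F}$ minimizing the empirical hinge risk $A_n(f)=\frac1n\sum_{i=1}^n\max(1-Y_if(X_i),0)$ over $\mathcal{F}$ (for $\{-1,1\}$-valued $f$, $A_n(f)=\frac2n\sum_{i=1}^n\mathbf{1}_{Y_i\ne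 f(X_i)}$, so this is empirical misclassification minimization). $a\vee b=\max(a,b)$. *)

(* Defs.v *)
From HB Require Import structures.
From mathcomp Require Import all_boot all_order all_algebra.
From mathcomp Require Import all_classical all_reals all_analysis.
Set Implicit Arguments. Unset Strict Implicit. Unset Printing Implicit Defensive.
Import Order.TTheory GRing.Theory Num.Theory.
Local Open Scope classical_set_scope.
Local Open Scope ring_scope.

(* Labels Y in {-1,1} are encoded by bool: true <-> 1, false <-> -1.
   A prediction rule X -> {-1,1} is a function X -> bool. *)
Definition lab {R : realType} (b : bool) : R := if b then 1 else -1.

Section Defs.
Context {R : realType} {d : measure_display} {X : measurableType d}.

Definition risk (pi : probability (X * bool)%type R) (f : X -> bool) : R :=
  fine (pi [set p | p.2 != f p.1]).

Definition cond_prob_version (pi : probability (X * bool)%type R) (eta : X -> R) :=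
  measurable_fun setT eta /\ (forall x, 0 <= eta x <= 1) /\
  forall A : set X, measurable A ->
    pi (A `*` [set true]) = (\int[pi]_(p in A `*` setT) (eta p.1)%:E)%E.

(* Bayes rule f* = sign(2 eta - 1), with sign(0) := 1 *)
Definition bayes (eta : X -> R) : X -> bool := fun x => 0 <= 2 * eta x - 1.

Definition margin_assumption (pi : probability (X * bool)%type R) (eta : X -> R)
    (kappa c0 : R) :=
  forall f : X -> bool, measurable_fun setT f ->
    (\int[pi]_p (`| lab (f p.1) - lab (bayes eta p.1) | : R)%:E
      <= (c0 * (risk pi f - risk pi (bayes eta)) `^ (kappa^-1))%:E)%E.

Definition emp_hinge (n : nat) (s : 'I_n -> X * bool) (f : X -> bool) : R :=
  n%:R^-1 * \sum_(i < n) Num.max (1 - lab (s i).2 * lab (f (s i).1)) 0.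

End Defs.

Definition mutually_independent {R : realType} {dO : measure_display}
    {Omega : measurableType dO} (P : probability Omega R)
    {dT : measure_display} {T : measurableType dT} (n : nat)
    (D : 'I_n -> Omega -> T) :=
  forall B : 'I_n -> set T, (forall i, measurable (B i)) ->
    P (\bigcap_(i in [set: 'I_n]) (D i @^-1` B i)) =
    (\prod_(i < n) P (D i @^-1` B i))%E.

(* Main.v *)
Require Import Defs.
From HB Require Import structures.
From mathcomp Require Import all_boot all_order all_algebra.
From mathcomp Require Import all_classical all_reals all_analysis.
From mathcomp Require Import measurable_realfun ring lra.
Import Order.TTheory GRing.Theory Num.Theory.
Local Open Scope classical_set_scope.
Local Open Scope ring_scope.

(* Let [e_j] be the excess risk of [F j], [k] an index minimizing it, [v_j] the
   probability that [F j] and [F k] disagree and [p_j] the probability that ERM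
   selects [j].  Selecting [j] forces the empirical error of [F j] to be at most
   that of [F k], so Chernoff's bound gives, for [0 < l <= 1/2],
     [p_j <= exp (- n g_j)]   with   [g_j = l (e_j - e_k) - 2 l^2 v_j].
   Hence [sum_j p_j n g_j] is at most the entropy of [p], thus at most [ln M];
   no union bound or integration of tails is needed.  The margin assumption
   bounds [v_j] by [c0/2 (e_j^(1/kappa) + e_k^(1/kappa))], and Jensen's inequality
   turns this into an inequality for [x = sum_j p_j (e_j - e_k)],
     [l x <= 2 l^2 c0 (x + e_k)^(1/kappa) + ln M / n],
   from which the theorem follows by optimizing [l]. *)

Set Implicit Arguments.
Unset Strict Implicit.

(** * Convexity and entropy inequalities on the real line *)

Lemma powR_le_tangent {R : realType} {y a : R} :
  0 <= y -> 0 < a <= 1 -> y `^ a <= 1 + a * (y - 1).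
Proof.
move=> y0 /andP[a0 a1]; have [->|yN0] := eqVneq y 0.
  rewrite powR0 ?gt_eqF//; lra.
have yp : 0 < y by rewrite lt_neqAle eq_sym yN0.
rewrite /powR (negbTE yN0); set t := ln y; set s := a * t.
have es : 0 < expR s by exact: expR_gt0.
have h1 : expR s * (1 + (t - s)) <= y.
  by rewrite -[leRHS]lnK ?posrE// -/t -{2}(subrKC s t) expRD ler_pM2l// expR_ge1Dx.
have h2 : expR s * (1 - s) <= 1.
  by rewrite -[leRHS](expRxMexpNx_1 s) ler_pM2l// expR_ge1Dx.
(* The weights [a] and [1 - a] cancel the first-order terms, since [a * (t - s) = (1 - a) * s] for
   [s = a * t]. *)
have -> : expR s = a * (expR s * (1 + (t - s))) + (1 - a) * (expR s * (1 - s)).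
  by rewrite /s; ring.
have h3 := ler_wpM2l (ltW a0) h1.
have h4 : (1 - a) * (expR s * (1 - s)) <= (1 - a) * 1 by apply: ler_wpM2l; lra.
lra.
Qed.

(** Each power lies below the tangent at the mean [y], and averaging the tangent returns the power
    of [y]. A zero mean, where the slope would divide by [y], is treated apart. *)
Lemma jensen_powR {R : realType} {I : finType} {p e : I -> R} {a : R} :
  0 < a <= 1 -> (forall j, 0 <= p j) -> \sum_j p j = 1 -> (forall j, 0 <= e j) ->
  \sum_j p j * e j `^ a <= (\sum_j p j * e j) `^ a.
Proof.
move=> a01 p0 p1 e0; have /andP[a0 _] := a01.
set y := \sum_j p j * e j.
have pe0 j : 0 <= p j * e j by rewrite mulr_ge0.
have y0 : 0 <= y by exact: sumr_ge0.
have [yE|yN0] := eqVneq y 0.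
  have pe j : p j * e j = 0.
    by move: yE => /(psumr_eq0P (fun j _ => pe0 j)) ->.
  rewrite yE powR0 ?gt_eqF// big1// => j _.
  have /eqP := pe j; rewrite mulf_eq0 => /orP[] /eqP ->; first by rewrite mul0r.
  by rewrite powR0 ?gt_eqF// mulr0.
have yp : 0 < y by rewrite lt_neqAle eq_sym yN0.
apply: (@le_trans _ _ (\sum_j y `^ a * (p j * (1 - a) + a / y * (p j * e j)))).
  apply: ler_sum => j _; rewrite -{1}(mulfVK yN0 (e j)) powRM ?divr_ge0//.
  have := powR_le_tangent (divr_ge0 (e0 j) y0) a01.
  move=> /(ler_wpM2l (mulr_ge0 (p0 j) (powR_ge0 y a))).
  rewrite -mulrA [y `^ a * _ in leLHS]mulrC => /le_trans; apply.
  by rewrite le_eqVlt; apply/orP; left; apply/eqP; field.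
rewrite -mulr_sumr big_split/= -mulr_suml -mulr_sumr p1 -/y mul1r divfK//.
by rewrite subrK mulr1.
Qed.

(* Since [ln u <= u - 1], the mean of [a] is at most the entropy of [p]. *)
Lemma entropy_bound {R : realType} {M : nat} {p a : 'I_M -> R} :
  (0 < M)%N -> (forall j, 0 <= p j) -> \sum_j p j = 1 ->
  (forall j, p j * expR (a j) <= 1) -> \sum_j p j * a j <= ln M%:R.
Proof.
move=> M0 p0 p1 pa; have Mp : 0 < M%:R :> R by rewrite ltr0n.
have -> : ln M%:R = \sum_j p j * ln M%:R by rewrite -mulr_suml p1 mul1r.
rewrite -subr_le0 -sumrB.
(* [p j * (a j - ln M) <= p j * (expR (a j) / M - 1) <= 1 / M - p j], and the last terms sum to
   zero. *)
apply: (@le_trans _ _ (\sum_(j < M) (M%:R^-1 - p j))).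
  apply: ler_sum => j _; rewrite -mulrBr.
  have /(ler_wpM2l (p0 j)) := expR_ge1Dx (a j - ln M%:R).
  rewrite expRD expRN lnK ?posrE// mulrA.
  have : p j * expR (a j) / M%:R <= 1 / M%:R by rewrite ler_pM2r ?invr_gt0.
  rewrite div1r [p j * (1 + _)]mulrDr mulr1; lra.
by rewrite sumrB p1 sumr_const card_ord -[_^-1 *+ M]mulr_natr mulVf ?gt_eqF// subrr.
Qed.

(** [expR u <= 1 / (1 - u)], and [(1 + u + 2 * u ^+ 2) * (1 - u) = 1 + u ^+ 2 * (1 - 2 * u)] is at
    least [1] because [u <= 1/2]. *)
Lemma expR_le_quadratic {R : realType} {u : R} :
  `|u| <= 2^-1 -> expR u <= 1 + u + 2 * u ^+ 2.
Proof.
rewrite ler_norml => /andP[u1 u2].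
have h : expR u * (1 - u) <= 1.
  by rewrite -[leRHS](expRxMexpNx_1 u) ler_pM2l ?expR_gt0// expR_ge1Dx.
have h1 : 0 < 1 - u by lra.
rewrite -(ler_pM2r h1) (le_trans h)//; nra.
Qed.

(** Apart from boundary cases, the best [l] gives [x^2 <= 8 c (x + e)^(1/kappa) L]. The larger of
    [x] and [e] then decides the rate: [e] leads to the square root, [x] to the power of [L]. *)
Lemma solve_fixed_point {R : realType} {x e L c kappa C : R} :
  1 <= kappa -> 0 < c -> 0 <= L -> 0 <= x <= 1 -> 0 <= e ->
  (forall l, 0 < l <= 2^-1 ->
    l * x <= 2 * l ^+ 2 * (c * (x + e) `^ kappa^-1) + L) ->
  16 <= C -> 16 * c <= C ->
  x <= C * (Num.sqrt (e `^ kappa^-1 * L) + L `^ (kappa / (2 * kappa - 1))).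
Proof.
move=> k1 c0 L0 /andP[x0 x1] e0 H C1 C2.
have k0 : 0 < kappa by lra.
have k21 : 0 < 2 * kappa - 1 by lra.
set b := kappa / _; set a := kappa^-1.
have a0 : 0 <= a by rewrite invr_ge0 ltW.
have b0 : 0 < b by rewrite divr_gt0.
have b1 : b <= 1 by rewrite ler_pdivrMr//; lra.
have C0 : 0 <= C by lra.
have [->|xN0] := eqVneq x 0.
  by rewrite mulr_ge0 ?addr_ge0 ?sqrtr_ge0 ?powR_ge0.
have xp : 0 < x by rewrite lt_neqAle eq_sym xN0.
have sq0 := sqrtr_ge0 (e `^ a * L).
have Lb0 := powR_ge0 L b.
have fin1 : x <= C * L `^ b ->
    x <= C * (Num.sqrt (e `^ a * L) + L `^ b).
  by move=> /le_trans; apply; rewrite ler_wpM2l// lerDr.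
have fin2 : x <= C * Num.sqrt (e `^ a * L) ->
    x <= C * (Num.sqrt (e `^ a * L) + L `^ b).
  by move=> /le_trans; apply; rewrite ler_wpM2l// lerDl.
(* For [1 <= L] the power of [L] already exceeds [x <= 1]. For [L < 1] the exponent [b <= 1] gives
   [L <= L^b], which serves when [l] is capped. *)
have [L1|L1] := leP 1 L.
  have h : 1 <= L `^ b.
    by rewrite -(powRr0 L) ler_powR// ltW.
  apply: fin1; nra.
(* [l = x / (4 V)] minimizes [2 l^2 V - l x]; when it exceeds the cap [1/2], the
   choice [l = 1/2] gives [x <= 4 L]. *)
set V := c * (x + e) `^ a in H.
have V0 : 0 <= V by rewrite mulr_ge0 ?powR_ge0// ltW.
have [xV|xV] := ltP (2 * V) x.
  have := H 2^-1 _; rewrite invr_gt0 ltr0n lexx => /(_ isT) h.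
  have {h}x4 : x <= 4 * L by lra.
  have Lp : 0 < L by lra.
  have h : L <= L `^ b.
    by rewrite ger1_powR// Lp ltW.
  apply: fin1; nra.
have Vp : 0 < V by lra.
have V4 : 0 < 4 * V by lra.
have V8 : 0 < 8 * V by lra.
have x8 : x ^+ 2 <= 8 * V * L.
  have := H (x / (4 * V)) _.
  have -> : 0 < x / (4 * V) <= 2^-1.
    by apply/andP; split; [rewrite divr_gt0|rewrite ler_pdivrMr//; lra].
  move=> /(_ isT).
  have -> : x / (4 * V) * x = 2 * (x ^+ 2 / (8 * V)) by field; rewrite gt_eqF.
  have -> : 2 * (x / (4 * V)) ^+ 2 * V = x ^+ 2 / (8 * V) by field; rewrite gt_eqF.
  move=> h; have {h} : x ^+ 2 / (8 * V) <= L by lra.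
  by rewrite ler_pdivrMr// => /le_trans; apply; lra.
have two z : 0 <= z -> (z + z) `^ a <= 2 * z `^ a.
  move=> z0; rewrite -mulr2n -[z *+ 2]mulr_natl powRM// ler_wpM2r ?powR_ge0//.
  by rewrite ler1_powR ?ler1n// invf_le1.
have mono s t : 0 <= s -> s <= t -> s `^ a <= t `^ a.
  by move=> s0 st; rewrite ge0_ler_powR// nnegrE// (le_trans s0).
(* The larger of [x] and [e] absorbs the other at the cost of a factor [2], so the [8] of [x8]
   becomes [16]. *)
have [xe|xe] := leP x e.
  have Ve : V <= c * (2 * e `^ a).
    apply: ler_wpM2l; first exact: ltW.
  apply: le_trans (two _ e0).
    by apply: mono; lra.
  apply: fin2.
  rewrite -(ler_pXn2r (_ : 0 < 2)%N) ?nnegrE ?mulr_ge0 ?sqrtr_ge0//.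
  rewrite exprMn sqr_sqrtr ?mulr_ge0 ?powR_ge0//.
  have ea := powR_ge0 e a.
  apply: (le_trans x8); apply: (@le_trans _ _ (16 * c * (e `^ a * L))).
    nra.
  rewrite ler_wpM2r ?mulr_ge0//; nra.
have Vx : V <= c * (2 * x `^ a).
  apply: ler_wpM2l; first exact: ltW.
  apply: le_trans (two _ x0).
  by apply: mono; lra.
apply: fin1.
have xa : 0 < x `^ a by rewrite powR_gt0.
have xL : x `^ (2 - a) <= 16 * c * L.
  rewrite powRB// ?xN0 ?implybT// powR_mulrn// ler_pdivrMr//.
  apply: (le_trans x8); nra.
(* The exponents [2 - 1/kappa] and [b] are inverse to each other, so raising [xL] to the power [b]
   isolates [x]. *)
have -> : x = (x `^ (2 - a)) `^ b.
  rewrite -powRrM.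
  have -> : (2 - a) * b = 1 by rewrite /a /b; field; rewrite !gt_eqF.
  by rewrite powRr1.
apply: (@le_trans _ _ ((16 * c * L) `^ b)).
  by apply: ge0_ler_powR; rewrite ?nnegrE ?powR_ge0//; [exact: ltW|nra].
apply: (@le_trans _ _ ((C * L) `^ b)).
  apply: ge0_ler_powR; rewrite ?nnegrE; [exact: ltW|nra|nra|].
  by rewrite ler_wpM2r.
rewrite powRM// ler_wpM2r// ler1_powR//; lra.
Qed.

(** * Finite-valued random variables and the Chernoff bound *)

Lemma integral_finite_valued {R : realType} {d : measure_display}
    {T : measurableType d} (P : probability T R) {K : finType} {w : T -> K}
    (g : K -> R) :
  (forall k, measurable [set x | w x = k]) -> (forall k, 0 <= g k) ->
  (\int[P]_x (g (w x))%:E = (\sum_k fine (P [set x | w x = k]) * g k)%:E)%E.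
Proof.
move=> mw g0.
transitivity (\int[P]_x (\sum_k (g k)%:E * (\1_[set y | w y = k] x)%:E))%E.
  apply: eq_integral => x _; rewrite (bigD1 (w x))//= big1 ?adde0.
    by rewrite indicE mem_set// mule1.
  by move=> k kw; rewrite indicE memNset ?mule0//= => /esym/eqP; rewrite (negbTE kw).
have mI k : measurable_fun setT (EFin \o (\1_[set y | w y = k] : T -> R)).
  exact/measurable_EFinP/measurable_indic.
rewrite ge0_integral_sum//; last 2 first.
- by move=> k; exact: measurable_funeM (mI k).
- by move=> k x _; rewrite mule_ge0// lee_fin.
rewrite -sumEFin; apply: eq_bigr => k _.
rewrite ge0_integralZl_EFin//; last exact: mI.
by rewrite integral_indic// setIT EFinM muleC fineK// fin_num_measure.
Qed.

(** Obtained by integrating the indicator of [B] along [w]. It turns comparisons of events into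
    linear arithmetic on a finite table of cells. *)
Lemma prob_finite_valued {R : realType} {d : measure_display}
    {T : measurableType d} (P : probability T R) {K : finType} {w : T -> K}
    (B : pred K) :
  (forall k, measurable [set x | w x = k]) ->
  fine (P [set x | B (w x)]) = \sum_(k | B k) fine (P [set x | w x = k]).
Proof.
move=> mw.
have mB : measurable [set x | B (w x)].
  rewrite (_ : [set _ | _] = \bigcup_(k in [set k | B k]) [set x | w x = k]).
    by apply: fin_bigcup_measurable => //; exact: finite_finset.
  by apply/seteqP; split => [x Bx|x [k Bk /= ->]]//; exists (w x).
have : (\int[P]_x ((B (w x))%:R : R)%:E = P [set x | B (w x)])%E.
  rewrite -[in RHS](setIT [set x | B (w x)]) -integral_indic//.
  apply: eq_integral => x _; rewrite indicE.
  case: (boolP (B (w x))) => h; first by rewrite mem_set.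
  by rewrite memNset//=; exact/negP.
rewrite (integral_finite_valued (g := fun k => (B k)%:R) P mw)// => <- /=.
by rewrite [RHS]big_mkcond; apply: eq_bigr => k _; case: (B k); rewrite ?mulr1 ?mulr0.
Qed.

Lemma sum_prob_fibers {R : realType} {d : measure_display}
    {T : measurableType d} (P : probability T R) {K : finType} {w : T -> K} :
  (forall k, measurable [set x | w x = k]) ->
  \sum_k fine (P [set x | w x = k]) = 1.
Proof.
move=> mw; rewrite -(prob_finite_valued P (xpredT : pred K) mw).
by rewrite (_ : [set _ | _] = setT) ?probability_setT//; apply/seteqP; split.
Qed.

(** On [A] the exponential of [- l] times the sum is at least [1], and by independence its mean is
    the [n]-th power of a one-observation moment. *)
Lemma chernoff_finite_valued {R : realType} {dO dT : measure_display}
    {Omega : measurableType dO} {T : measurableType dT}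
    (P : probability Omega R) (mu : probability T R) {K : finType} {n : nat}
    (D : 'I_n -> Omega -> T) (w : T -> K) (c : K -> R) (A : set Omega) (l : R) :
  (forall k, measurable [set x | w x = k]) ->
  (forall i, measurable_fun setT (D i)) ->
  (forall i B, measurable B -> P (D i @^-1` B) = mu B) ->
  mutually_independent P D -> measurable A -> 0 <= l ->
  (forall o, A o -> \sum_(i < n) c (w (D i o)) <= 0) ->
  fine (P A) <= (\sum_k fine (mu [set x | w x = k]) * expR (- (l * c k))) ^+ n.
Proof.
move=> mw mD idD iD mA l0 Ac.
pose W o : {ffun 'I_n -> K} := [ffun i => w (D i o)].
have WE (s : {ffun 'I_n -> K}) : [set o | W o = s] =
    \bigcap_(i in [set: 'I_n]) (D i @^-1` [set x | w x = s i]).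
  apply/seteqP; split => [x /= <- i _ /=|x /= h]; first by rewrite ffunE.
  by apply/ffunP => i; rewrite ffunE; exact: h.
have mDw i k : measurable (D i @^-1` [set x | w x = k]).
  by rewrite -[X in measurable X]setTI; exact: mD.
have mW s : measurable [set o | W o = s].
  by rewrite WE; apply: fin_bigcap_measurable => //; exact: finite_finset.
have PW s : fine (P [set o | W o = s]) = \prod_i fine (mu [set x | w x = s i]).
  rewrite WE iD// (eq_bigr (fun i => (fine (mu [set x | w x = s i]))%:E)).
    by rewrite prodEFin.
  by move=> i _; rewrite idD// fineK// fin_num_measure.
(* Summing over the finitely many values of [W] makes the product rule for
   events sufficient: no expectation of a product has to be computed. *)
pose B (s : {ffun 'I_n -> K}) := \sum_i c (s i) <= 0.
apply: (@le_trans _ _ (fine (P [set o | B (W o)]))).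
  have mB : measurable [set o | B (W o)].
    rewrite (_ : [set _ | _] = \bigcup_(s in [set s | B s]) [set o | W o = s]).
      by apply: fin_bigcup_measurable => //; exact: finite_finset.
    by apply/seteqP; split => [x Bx|x [k Bk /= ->]]//; exists (W x).
  rewrite fine_le ?fin_num_measure// le_measure ?inE// => o Ao.
  rewrite /= /B (eq_bigr (fun i => c (w (D i o)))) ?Ac// => i _.
  by rewrite ffunE.
rewrite prob_finite_valued// big_mkcond.
(* Distributivity expands the [n]-th power into a sum over the same maps [s], so the two sums
   compare term by term. *)
rewrite -[X in _ ^+ X]card_ord -prodr_const bigA_distr_bigA.
apply: ler_sum => s _.
have q0 k : 0 <= fine (mu [set x | w x = k]) by rewrite fine_ge0.
rewrite PW big_split/= -expR_sum.
have pq0 : 0 <= \prod_i fine (mu [set x | w x = s i]) by exact: prodr_ge0.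
case: ifP => [Bs|_]; last by rewrite mulr_ge0// expR_ge0.
rewrite ler_peMr// -[leLHS]expR0 ler_expR sumrN -mulr_sumr oppr_ge0.
by rewrite mulr_ge0_le0.
Qed.

Lemma sum_prod_type {R : nmodType} {A B : finType} (F : A * B -> R) :
  \sum_k F k = \sum_a \sum_b F (a, b).
Proof. by rewrite pair_bigA; apply: eq_bigr => -[]. Qed.

Lemma measurable_pair_fiber {d : measure_display} {T : measurableType d}
    {A B : Type} (f : T -> A) (g : T -> B) :
  (forall a, measurable [set x | f x = a]) ->
  (forall b, measurable [set x | g x = b]) ->
  forall k, measurable [set x | (f x, g x) = k].
Proof.
move=> mf mg [a b]; rewrite (_ : [set _ | _] = [set x | f x = a] `&` [set x | g x = b]).
  exact: measurableI.
by apply/seteqP; split => [x /= [<- <-]|x [/= -> ->]].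
Qed.

Lemma measurable_bool_fiber {d : measure_display} {T : measurableType d}
    (f : T -> bool) (b : bool) :
  measurable_fun setT f -> measurable [set x | f x = b].
Proof.
by move=> mf; rewrite -[X in measurable X]setTI; exact: (mf measurableT [set b]).
Qed.

Lemma measurable_neqb {d : measure_display} {T : measurableType d}
    (f g : T -> bool) :
  measurable_fun setT f -> measurable_fun setT g ->
  measurable_fun setT (fun x => f x != g x).
Proof.
move=> mf mg; rewrite (_ : (fun _ => _) = (fun x => if f x then ~~ g x else g x)).
  by apply: measurable_fun_ifT => //; exact: measurable_neg.
by apply/funext => x; case: (f x); case: (g x).
Qed.

(** * Risk, disagreement and the Bayes rule *)

Section rules.
Context {R : realType} {d : measure_display} {X : measurableType d}.
Variable pi : probability (X * bool)%type R.
Implicit Types f g h : X -> bool.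

Lemma measurable_rule f :
  measurable_fun setT f -> measurable_fun setT (fun p : X * bool => f p.1).
Proof. by move=> mf; exact: (measurableT_comp mf). Qed.

Lemma measurable_error f :
  measurable_fun setT f -> measurable_fun setT (fun p : X * bool => p.2 != f p.1).
Proof. by move=> mf; apply: measurable_neqb => //; exact: measurable_rule. Qed.

Lemma risk_ge0 f : 0 <= risk pi f.
Proof. by rewrite fine_ge0. Qed.

Lemma risk_le1 f : measurable_fun setT f -> risk pi f <= 1.
Proof.
move=> mf; have mS := measurable_bool_fiber true (measurable_error mf).
by rewrite -lee_fin fineK ?fin_num_measure// probability_le1.
Qed.

(** Half the L1 distance under [pi] between the rules seen as functions into {-1,1}. *)
Definition disagreement f g : R := fine (pi [set p | f p.1 != g p.1]).

Lemma disagreementC f g : disagreement f g = disagreement g f.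
Proof.
by congr (fine (pi _)); apply/seteqP; split => p /=; rewrite eq_sym.
Qed.

Lemma measurable_disagreement f g :
  measurable_fun setT f -> measurable_fun setT g ->
  measurable [set p : X * bool | f p.1 != g p.1].
Proof.
move=> mf mg; apply: (measurable_bool_fiber true).
by apply: measurable_neqb; exact: measurable_rule.
Qed.

Lemma disagreement_triangle f g h :
  measurable_fun setT f -> measurable_fun setT g -> measurable_fun setT h ->
  disagreement f h <= disagreement f g + disagreement g h.
Proof.
move=> mf mg mh.
have mfg := measurable_disagreement mf mg.
have mgh := measurable_disagreement mg mh.
have mfh := measurable_disagreement mf mh.
rewrite -lee_fin EFinD !fineK ?fin_num_measure//.
apply: le_trans (measureU2 _ mfg mgh).
rewrite le_measure ?inE//; first exact: measurableU.
by move=> p /=; case: (f p.1); case: (g p.1); case: (h p.1); auto.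
Qed.

Section bayes_rule.
Variable eta : X -> R.
Hypothesis cond_eta : cond_prob_version pi eta.

Lemma measurable_bayes : measurable_fun setT (bayes eta).
Proof.
case: cond_eta => meta _; apply: measurable_fun_ler => //.
by apply: measurable_funB => //; apply: measurable_funM.
Qed.

Let label_split (A : set X) : measurable A ->
  pi (A `*` setT) = (pi (A `*` [set true]) + pi (A `*` [set false]))%E.
Proof.
move=> mA; rewrite -measureU//; [|exact: measurableX..|].
  congr (pi _); apply/seteqP; split => [[x []] /= [Ax _]|[x y] /=]; auto.
  by case=> -[].
by apply/seteqP; split => // -[x y] /= [[_ ->] []].
Qed.

(** The mass of label [true] over [A] is the integral of [eta >= 1/2], hence at least half of the
    mass of both labels together. *)
Lemma label_true_likely (A : set X) : measurable A ->
  (forall x, A x -> 1 <= 2 * eta x) ->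
  fine (pi (A `*` [set false])) <= fine (pi (A `*` [set true])).
Proof.
move=> mA Ae; have [meta [eta01 etaE]] := cond_eta.
have mAT : measurable (A `*` [set: bool]) by exact: measurableX.
have mAt b : measurable (A `*` [set b : bool]) by exact: measurableX.
have : ((2^-1)%:E * pi (A `*` setT) <= pi (A `*` [set true]))%E.
  rewrite etaE// -integral_cst//; apply: ge0_le_integral => //=.
  - by apply/measurable_EFinP/measurable_funTS; exact: (measurableT_comp meta).
  - by move=> p [Ap _]; rewrite lee_fin; have := Ae _ Ap; lra.
rewrite label_split// -[pi (_ `*` [set true])]fineK ?fin_num_measure//.
rewrite -[pi (_ `*` [set false])]fineK ?fin_num_measure//.
by rewrite -EFinD -EFinM lee_fin; lra.
Qed.

Lemma label_false_likely (A : set X) : measurable A ->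
  (forall x, A x -> 2 * eta x <= 1) ->
  fine (pi (A `*` [set true])) <= fine (pi (A `*` [set false])).
Proof.
move=> mA Ae; have [meta [eta01 etaE]] := cond_eta.
have mAT : measurable (A `*` [set: bool]) by exact: measurableX.
have mAt b : measurable (A `*` [set b : bool]) by exact: measurableX.
have : (pi (A `*` [set true]) <= (2^-1)%:E * pi (A `*` setT))%E.
  rewrite etaE// -integral_cst//; apply: ge0_le_integral => //=.
  - by move=> p _; rewrite lee_fin; case/andP: (eta01 p.1).
  - by apply/measurable_EFinP/measurable_funTS; exact: (measurableT_comp meta).
  - by move=> p [Ap _]; rewrite lee_fin; have := Ae _ Ap; lra.
rewrite label_split// -[pi (_ `*` [set true])]fineK ?fin_num_measure//.
rewrite -[pi (_ `*` [set false])]fineK ?fin_num_measure//.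
by rewrite -EFinD -EFinM lee_fin; lra.
Qed.

(** The errors cancel wherever [f] agrees with the Bayes rule. On each of the two regions of
    disagreement, the Bayes label is the likelier one. *)
Lemma risk_bayes_le f : measurable_fun setT f -> risk pi (bayes eta) <= risk pi f.
Proof.
move=> mf; have mb := measurable_bayes.
pose w (p : X * bool) := (p.2, (f p.1, bayes eta p.1)).
have mw k : measurable [set p | w p = k].
  apply: measurable_pair_fiber => [b|].
    by apply: measurable_bool_fiber.
  by apply: measurable_pair_fiber => b; apply: measurable_bool_fiber;
    exact: measurable_rule.
have -> : risk pi f = \sum_(k | k.1 != k.2.1) fine (pi [set p | w p = k]).
  exact: (prob_finite_valued pi (fun k => k.1 != k.2.1) mw).
have -> : risk pi (bayes eta) = \sum_(k | k.1 != k.2.2) fine (pi [set p | w p = k]).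
  exact: (prob_finite_valued pi (fun k => k.1 != k.2.2) mw).
(* The cells of the joint table are rectangles, the form that the two label comparisons require. *)
have wE y b c : [set p | w p = (y, (b, c))] =
    ([set x | f x = b] `&` [set x | bayes eta x = c]) `*` [set y].
  by apply/seteqP; split => [[x z] [/= <- <- <-]|[x z] [[/= <- <-] <-]].
have mA b c : measurable ([set x | f x = b] `&` [set x | bayes eta x = c]).
  by apply: measurableI; exact: measurable_bool_fiber.
have h1 := @label_true_likely _ (mA false true) _.
have h2 := @label_false_likely _ (mA true false) _.
rewrite [leLHS]big_mkcond [leRHS]big_mkcond.
rewrite !sum_prod_type !big_bool/= !sum_prod_type !big_bool/=.
rewrite !wE; move: h1 h2.
have i1 x : ([set x | f x = false] `&` [set x | bayes eta x = true]) x ->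
    1 <= 2 * eta x by move=> [_]; rewrite /= /bayes; lra.
have i2 x : ([set x | f x = true] `&` [set x | bayes eta x = false]) x ->
    2 * eta x <= 1 by move=> [_]; rewrite /= /bayes => /negbT; rewrite -ltNge; lra.
move=> /(_ i1) h1 /(_ i2) h2; lra.
Qed.

(** The integrand of the margin assumption is [2] where the rules disagree and [0] elsewhere, whence
    [c0 / 2]. *)
Lemma margin_disagreement kappa c0 f : margin_assumption pi eta kappa c0 ->
  measurable_fun setT f ->
  disagreement f (bayes eta) <=
    c0 / 2 * (risk pi f - risk pi (bayes eta)) `^ kappa^-1.
Proof.
move=> ma mf; have mb := measurable_bayes; have := ma f mf.
pose w (p : X * bool) := (f p.1, bayes eta p.1).
have mw k : measurable [set p | w p = k].
  by apply: measurable_pair_fiber => b; apply: measurable_bool_fiber;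
    exact: measurable_rule.
have := integral_finite_valued pi
  (g := fun k : bool * bool => `|lab k.1 - lab k.2|) mw (fun _ => normr_ge0 _).
rewrite /w/= => ->; rewrite lee_fin => h.
have -> : disagreement f (bayes eta) =
    \sum_(k | k.1 != k.2) fine (pi [set p | w p = k]).
  exact: (prob_finite_valued pi (fun k => k.1 != k.2) mw).
rewrite [leLHS]big_mkcond; move: h.
rewrite !sum_prod_type !big_bool/= /lab !subrr normr0 -/w.
have -> : `|1 - -1| = 2 :> R by rewrite opprK ger0_norm.
have -> : `|-1 - 1| = 2 :> R by rewrite -opprD normrN ger0_norm.
rewrite /w; lra.
Qed.

End bayes_rule.

(** * Empirical risk and the tail of its differences *)

Lemma max_hinge (y b : bool) :
  Num.max (1 - lab y * lab b) 0 = 2 * (y != b)%:R :> R.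
Proof.
by case: y; case: b; rewrite /lab /= /Num.max; case: ifP => //; lra.
Qed.

Lemma emp_hinge_le_sum n (s : 'I_n -> X * bool) f g : (0 < n)%N ->
  @emp_hinge R _ X n s f <= @emp_hinge R _ X n s g ->
  \sum_(i < n) (((s i).2 != f (s i).1)%:R - ((s i).2 != g (s i).1)%:R) <= 0 :> R.
Proof.
move=> n0; rewrite /emp_hinge ler_pM2l ?invr_gt0 ?ltr0n// -subr_le0 -sumrB.
rewrite (eq_bigr (fun i => 2 * (((s i).2 != f (s i).1)%:R - ((s i).2 != g (s i).1)%:R))).
  by rewrite -mulr_sumr pmulr_rle0.
by move=> i _; rewrite !max_hinge mulrBr.
Qed.

(** The difference of the error indicators lies in {-1,0,1}; its mean is the risk difference and its
    second moment the disagreement. The quadratic bound on [expR] thus controls its exponential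
    moment at [- l]. *)
Lemma empirical_error_tail {dO : measure_display} {Omega : measurableType dO}
    (P : probability Omega R) {n : nat} (D : 'I_n -> Omega -> (X * bool)%type)
    (A : set Omega) f g (l : R) :
  measurable_fun setT f -> measurable_fun setT g ->
  (forall i, measurable_fun setT (D i)) ->
  (forall i B, measurable B -> P (D i @^-1` B) = pi B) ->
  mutually_independent P D -> measurable A -> 0 < l <= 2^-1 ->
  (forall o, A o -> \sum_(i < n) (((D i o).2 != f (D i o).1)%:R -
                                  ((D i o).2 != g (D i o).1)%:R) <= 0 :> R) ->
  fine (P A) <=
    expR (- (n%:R * (l * (risk pi f - risk pi g) - 2 * l ^+ 2 * disagreement f g))).
Proof.
move=> mf mg mD idD iD mA /andP[l0 l1] Ac.
pose w (p : X * bool) := (p.2 != f p.1, p.2 != g p.1).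
pose c (k : bool * bool) : R := k.1%:R - k.2%:R.
have mw k : measurable [set p | w p = k].
  by apply: measurable_pair_fiber => b; apply: measurable_bool_fiber;
    exact: measurable_error.
have tail := chernoff_finite_valued (c := c) mw mD idD iD mA (ltW l0) Ac.
apply: (le_trans tail).
(* Writing the right side as an [n]-th power leaves a comparison for a single observation. *)
rewrite -mulrN expRM_natl.
apply: lerXn2r; rewrite ?nnegrE ?expR_ge0//.
  by apply: sumr_ge0 => k _; rewrite mulr_ge0 ?fine_ge0 ?expR_ge0.
pose q k := fine (pi [set p | w p = k]).
have rf : risk pi f = \sum_(k | k.1) q k.
  exact: (prob_finite_valued pi (fun k => k.1) mw).
have rg : risk pi g = \sum_(k | k.2) q k.
  exact: (prob_finite_valued pi (fun k => k.2) mw).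
(* Labels are binary, so exactly one rule errs precisely when the two rules disagree. *)
have dfg : disagreement f g = \sum_(k | k.1 != k.2) q k.
  rewrite -(prob_finite_valued pi (fun k => k.1 != k.2) mw).
  congr (fine (pi _)); apply/seteqP; split => p /=;
  by case: p.2; case: (f p.1); case: (g p.1).
have q1 : \sum_k q k = 1 by exact: sum_prob_fibers.
(* [1 + u <= expR u] replaces the target by an expression affine in the cell probabilities. *)
apply: le_trans (expR_ge1Dx _).
apply: (@le_trans _ _ (\sum_k q k * (1 - l * c k + 2 * (l * c k) ^+ 2))).
  apply: ler_sum => k _; apply: ler_wpM2l; first by rewrite fine_ge0.
  apply: le_trans (expR_le_quadratic _) _; last by rewrite sqrrN.
  rewrite normrN normrM gtr0_norm//.
  by case: k => -[] []; rewrite /c/= ?subrr ?normr0 ?subr0 ?sub0r ?normrN ?normr1; lra.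
rewrite big_mkcond/= in rf; rewrite big_mkcond/= in rg; rewrite big_mkcond/= in dfg.
move: q1; rewrite rf rg dfg !sum_prod_type !big_bool/= /c/=.
by move=> q1; lra.
Qed.

End rules.

Unset Implicit Arguments.
Set Strict Implicit.

(** * Assembly of the oracle inequality *)

Theorem theorem3 (R : realType) (d : measure_display) (X : measurableType d)
  (pi : probability (X * bool)%type R) (eta : X -> R) (kappa c0 : R)
  (M : nat) (hM : (0 < M)%N) (F : 'I_M -> X -> bool)
  (n : nat) (dO : measure_display) (Omega : measurableType dO)
  (P : probability Omega R) (D : 'I_n -> Omega -> (X * bool)%type)
  (erm : ('I_n -> X * bool) -> 'I_M) :
  cond_prob_version pi eta ->
  1 <= kappa -> 0 < c0 -> margin_assumption pi eta kappa c0 ->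
  (forall j, measurable_fun setT (F j)) ->
  (1 <= n)%N ->
  (* D_n = (X_i, Y_i)_{i<n} : i.i.d. copies of (X, Y) ~ pi *)
  (forall i, measurable_fun setT (D i)) ->
  (forall i B, measurable B -> P (D i @^-1` B) = pi B) ->
  mutually_independent P D ->
  (* erm selects an empirical hinge risk minimizer over F (any tie-breaking),
     and the resulting aggregate is a measurable function of the data *)
  (forall s j, @emp_hinge R _ X n s (F (erm s)) <= @emp_hinge R _ X n s (F j)) ->
  (forall j, measurable [set w | erm (fun i => D i w) = j]) ->
  let Rstar := risk pi (bayes eta) in
  let exc := fun j => risk pi (F j) - Rstar in
  let minexc := \big[Num.min/exc (Ordinal hM)]_(j < M) exc j in
  let C := 32 * Num.max 6 (Num.max (537 * c0) (16 * (2 * c0 + 3^-1))) in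
  (\int[P]_w (risk pi (F (erm (fun i => D i w))) - Rstar)%:E
   <= (minexc + C * (Num.sqrt (minexc `^ (kappa^-1) * ln M%:R / n%:R)
         + (ln M%:R / n%:R) `^ (kappa / (2 * kappa - 1))))%:E)%E.
Proof.
move=> eta_cond kappa1 c0_gt0 ma mF n1 mD idD iD ermP mErm; cbv zeta.
set Rstar := risk pi (bayes eta).
pose exc j := risk pi (F j) - Rstar.
set minexc := \big[_/_]_(j < M) _.
set C := 32 * _.
have mb := measurable_bayes eta_cond.
have exc0 j : 0 <= exc j by rewrite subr_ge0 risk_bayes_le.
(* The starting value of the iterated minimum is itself an excess risk, so the minimum is
   attained. *)
have [k minE] : exists k, minexc = exc k.
  rewrite /minexc -/(exc _); elim/big_ind : _ => [|x y [j ->] [k ->]|j _]; try by eexists.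
  by rewrite /Num.min; case: ifP; eexists.
have mink j : exc k <= exc j by rewrite -minE; exact: (bigmin_le _ j exc).
pose L : R := ln M%:R / n%:R.
have np : 0 < n%:R :> R by rewrite ltr0n.
have L0 : 0 <= L by rewrite divr_ge0 ?ln_ge0 ?ler1n// ltW.
pose p j := fine (P [set o | erm (fun i => D i o) = j]).
have p0 j : 0 <= p j by rewrite fine_ge0.
have p1 : \sum_j p j = 1 by exact: sum_prob_fibers.
(* [x] is the expected excess of ERM over the best rule of the family, [y] its expected excess over
   the Bayes rule. *)
pose x := \sum_j p j * (exc j - exc k).
pose y := \sum_j p j * exc j.
have xy : y = x + exc k.
  rewrite /x; under eq_bigr => j _ do rewrite mulrBr.
  by rewrite sumrB -mulr_suml p1 mul1r subrK.
rewrite (integral_finite_valued (g := exc) P mErm exc0) lee_fin.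
rewrite -/p -/y xy addrC minE lerD2l.
have x0 : 0 <= x by apply: sumr_ge0 => j _; rewrite mulr_ge0// subr_ge0.
have x1 : x <= 1.
  rewrite -p1 ler_sum// => j _; rewrite ler_piMr//.
  by have := risk_le1 pi (mF j); have := risk_ge0 pi (F k); rewrite /exc; lra.
have k0 : 0 < kappa by lra.
have a01 : 0 < kappa^-1 <= 1 by rewrite invr_gt0 k0 invf_le1.
have C1 : 16 <= C.
  have : 6 <= Num.max 6 (Num.max (537 * c0) (16 * (2 * c0 + 3^-1))).
    by rewrite le_max lexx.
  by rewrite /C; lra.
have C2 : 16 * c0 <= C.
  have : 537 * c0 <= Num.max 6 (Num.max (537 * c0) (16 * (2 * c0 + 3^-1))).
    by rewrite !le_max lexx orbT.
  by rewrite /C; lra.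
rewrite -[X in Num.sqrt X]mulrA -/L.
apply: (solve_fixed_point kappa1 c0_gt0 L0 _ (exc0 k)) => // [|l l01].
  by rewrite x0 x1.
have /andP[l0 l1] := l01.
pose v j := disagreement pi (F j) (F k).
have v_le j : v j <= c0 / 2 * (exc j `^ kappa^-1 + exc k `^ kappa^-1).
  apply: le_trans (disagreement_triangle pi (mF j) mb (mF k)) _.
  rewrite mulrDr lerD ?[disagreement pi (bayes eta) _]disagreementC//;
    exact: (margin_disagreement eta_cond ma).
(* The tail bound on the selection probability, with the exponential moved to the left as
   [entropy_bound] expects. *)
have tail j : p j * expR (n%:R * (l * (exc j - exc k) - 2 * l ^+ 2 * v j)) <= 1.
  rewrite -ler_pdivlMr ?expR_gt0// div1r -expRN.
  have -> : exc j - exc k = risk pi (F j) - risk pi (F k) by rewrite /exc; ring.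
  apply: (empirical_error_tail (mF j) (mF k) mD idD iD (mErm j) l01) => o /= ermj.
  apply: (emp_hinge_le_sum (s := fun i => D i o)) => //.
  by rewrite -ermj; exact: ermP.
have := entropy_bound hM p0 p1 tail.
have -> : \sum_j p j * (n%:R * (l * (exc j - exc k) - 2 * l ^+ 2 * v j)) =
    n%:R * (l * x - 2 * l ^+ 2 * \sum_j p j * v j).
  rewrite /x !mulr_sumr -sumrB mulr_sumr; apply: eq_bigr => j _; ring.
rewrite mulrC -ler_pdivlMr// -/L => lx.
have pv : \sum_j p j * v j <= c0 * y `^ kappa^-1.
  apply: (@le_trans _ _ (\sum_j p j * (c0 / 2 * (exc j `^ kappa^-1 + exc k `^ kappa^-1)))).
    by apply: ler_sum => j _; rewrite ler_wpM2l.
  have -> : \sum_j p j * (c0 / 2 * (exc j `^ kappa^-1 + exc k `^ kappa^-1)) =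
      c0 / 2 * (\sum_j p j * exc j `^ kappa^-1 + exc k `^ kappa^-1).
    rewrite -[in RHS](mul1r (exc k `^ _)) -p1 mulr_suml -big_split mulr_sumr/=.
    by apply: eq_bigr => j _; ring.
  have jen := jensen_powR a01 p0 p1 exc0.
  (* The mean excess [y] dominates the minimum [exc k], so both powers are bounded by that of [y]
     and [c0 / 2] doubles to [c0]. *)
  have ek : exc k `^ kappa^-1 <= y `^ kappa^-1.
    have [/ltW a0 _] := andP a01.
    have ky : exc k <= y by rewrite xy lerDr.
    by apply: ge0_ler_powR => //; rewrite nnegrE ?(le_trans (exc0 k) ky).
  have c2 : 0 <= c0 / 2 by lra.
  by apply: le_trans (ler_wpM2l c2 (lerD jen ek)) _; rewrite -/y; lra.
have l2 : 0 <= 2 * l ^+ 2 by rewrite mulr_ge0// sqr_ge0.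
by have := ler_wpM2l l2 pv; rewrite xy; lra.
Qed.
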